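(* Let $L_1=L_1(f,g)$ be the $E_7^{(1)}$ operator defined in the context. For each blow-up coordinate system below, substitute the given $(f,g)$ into the linear $q$-difference equation $L_1y(z)=0$ and set $g_1=0$ (restriction to the exceptional line); this gives the displayed three-term equation for $y$. Let $\lambda$ satisfy $q^\lambda=q^{3/2}\kappa_2/\kappa_1$. Then the indicated gauge transform $u(z)$ of $y(z)$ satisfies the variant of the $q$-Heun equation of degree $4$ $$\prod_{i=1}^4(x-h_iq^{1/2})\,u(x/q)+\prod_{i=1}^4(x-l_iq^{-1/2})\,u(qx)+\Bigl[-(q^{1/2}+q^{-1/2})x^4+\sum_{i=1}^4(h_i+l_i)\,x^3+Ex^2+(h_1h_2h_3h_4l_1l_2l_3l_4)^{1/2}\Bigl\{\sum_{i=1}^4(h_i^{-1}+l_i^{-1})\,x-(q^{1/2}+q^{-1/2})\Bigr\}\Bigr]u(x)=0$$ with $x=z$, with the following parameters, accessory parameter $E$ and choice of square root. (1) Point $P_1=(\nu_1,1/\nu_1)$: $(f,g)=(f_1g_1+\nu_1,\,g_1+1/\nu_1)$, with $f_1+\nu_1^2\neq0$. Setting $g_1=0$ gives $$\frac{q\prod_{i=5}^8(\kappa_1-\nu_iz)}{\kappa_1^4(\nu_1-z)z^2}y(qz)+\frac{\prod_{j=2}^4(q\nu_j-z)}{q\nu_1\nu_2\nu_3\nu_4z^2}y(z/q)+\Bigl\{-\frac{q(\kappa_1-\kappa_2)\prod_{j=2}^4(\nu_1-\nu_j)}{\kappa_1(f_1+\nu_1^2)\nu_2\nu_3\nu_4(q\nu_1-z)}+\frac{q\prod_{i=5}^8(\kappa_2-\nu_1\nu_i)}{\kappa_1\kappa_2^2\nu_1^2(\kappa_1\nu_1-\kappa_2z)}-\frac{(\kappa_1q\nu_1-\kappa_2z)\prod_{j=2}^4(q\nu_j-z)}{\kappa_1q\nu_1\nu_2\nu_3\nu_4(q\nu_1-z)z^2}-\frac{q\prod_{i=5}^8(\kappa_1-\nu_iz)}{\kappa_1^3z^2(\kappa_1\nu_1-\kappa_2z)}\Bigr\}y(z)=0,$$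 and $u(z)=z^\lambda y(z)/(q\nu_1-z)$ satisfies the degree-$4$ equation with $h_1=q^{3/2}\nu_1$, $h_i=q^{1/2}\nu_i$ $(i=2,3,4)$, $l_1=q^{1/2}\kappa_1/\nu_5$, $l_2=q^{1/2}\kappa_1/\nu_6$, $l_3=q^{1/2}\kappa_1/\nu_7$, $l_4=q^{1/2}\kappa_1/\nu_8$, $(h_1h_2h_3h_4l_1l_2l_3l_4)^{1/2}=q^3\kappa_1\nu_1\nu_2\nu_3\nu_4/\kappa_2$, and $$E=-q^{3/2}\Bigl(\frac{K_1}{\kappa_2(f_1+\nu_1^2)}+K_2\Bigr),$$ where $K_1=\nu_1(\kappa_1-\kappa_2)(\nu_1-\nu_2)(\nu_1-\nu_3)(\nu_1-\nu_4)$ and $$K_2=\kappa_1\nu_1\Bigl(\frac{-\nu_1+\nu_2+\nu_3+\nu_4}{\kappa_2}+\frac1{\nu_5}+\frac1{\nu_6}+\frac1{\nu_7}+\frac1{\nu_8}\Bigr)+\nu_2\nu_3\nu_4\Bigl(-\frac1{\nu_1}+\frac1{\nu_2}+\frac1{\nu_3}+\frac1{\nu_4}+\frac{\nu_5+\nu_6+\nu_7+\nu_8}{\kappa_2}\Bigr).$$ (2) Point $P_5=(\kappa_1/\nu_5,\nu_5/\kappa_2)$: $(f,g)=(f_1g_1+\kappa_1/\nu_5,\,g_1+\nu_5/\kappa_2)$, with $f_1\nu_5^2+\kappa_1\kappa_2\ne0$. Setting $g_1=0$ gives $$\frac{q\nu_5\prod_{j=6}^8(\kappa_1-\nu_jz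)}{\kappa_1^4z^2}y(qz)+\frac{\nu_5\prod_{i=1}^4(q\nu_i-z)}{q\nu_1\nu_2\nu_3\nu_4z^2(\kappa_1q-\nu_5z)}y(z/q)+\Bigl\{-\frac{q(\kappa_1-\kappa_2)\prod_{j=6}^8(\nu_5-\nu_j)}{\kappa_1(\kappa_1\kappa_2+f_1\nu_5^2)(\kappa_1-\nu_5z)}-\frac{\kappa_2\nu_5\prod_{i=1}^4(q\nu_i-z)}{q\kappa_1\nu_1\nu_2\nu_3\nu_4z^2(\kappa_2q-\nu_5z)}+\frac{q\prod_{i=1}^4(\kappa_2-\nu_i\nu_5)}{\kappa_1\kappa_2\nu_1\nu_2\nu_3\nu_4\nu_5(\kappa_2q-\nu_5z)}-\frac{q\nu_5(\kappa_2-\nu_5z)\prod_{j=6}^8(\kappa_1-\nu_jz)}{\kappa_1^3\kappa_2z^2(\kappa_1-\nu_5z)}\Bigr\}y(z)=0,$$ and $u(z)=z^\lambda y(z)/(\kappa_1-\nu_5z)$ satisfies the degree-$4$ equation with $h_i=q^{1/2}\nu_i$ $(i=1,2,3,4)$, $l_1=\kappa_1/(q^{1/2}\nu_5)$, $l_2=q^{1/2}\kappa_1/\nu_6$, $l_3=q^{1/2}\kappa_1/\nu_7$, $l_4=q^{1/2}\kappa_1/\nu_8$, $(h_1h_2h_3h_4l_1l_2l_3l_4)^{1/2}=q^2\kappa_1\nu_1\nu_2\nu_3\nu_4/\kappa_2$, and $$E=-q^{1/2}\Bigl(\frac{K_1}{\kappa_2\nu_5(f_1\nu_5^2+\kappa_1\kappa_2)}+K_2\Bigr),$$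 where $K_1=q\nu_1\nu_2\nu_3\nu_4(\kappa_1-\kappa_2)(\nu_5-\nu_6)(\nu_5-\nu_7)(\nu_5-\nu_8)$ and $$K_2=\frac{\kappa_1\kappa_2}{\nu_5}\Bigl(\frac{\nu_1+\nu_2+\nu_3+\nu_4}{\kappa_2}-\frac1{\nu_5}+\frac1{\nu_6}+\frac1{\nu_7}+\frac1{\nu_8}\Bigr)+q\nu_1\nu_2\nu_3\nu_4\frac{\nu_5}{\kappa_2}\Bigl(\frac1{\nu_1}+\frac1{\nu_2}+\frac1{\nu_3}+\frac1{\nu_4}+\frac{-\nu_5+\nu_6+\nu_7+\nu_8}{\kappa_2}\Bigr).$$ In both cases $f_1$ may be regarded as an accessory parameter. For $P_i=(\nu_i,1/\nu_i)$, $i=2,3,4$, the statement (1) holds with $\nu_1$ and $\nu_i$ exchanged; for $P_i=(\kappa_1/\nu_i,\nu_i/\kappa_2)$, $i=6,7,8$, the statement (2) holds with $\nu_5$ and $\nu_i$ exchanged.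
   Context: $q,\kappa_1,\kappa_2,\nu_1,\dots,\nu_8$ are non-zero complex parameters with $\kappa_1^2\kappa_2^2=q\,\nu_1\nu_2\cdots\nu_8$. $T_zy(z)=y(qz)$, $T_z^{-1}y(z)=y(z/q)$, and $z^\lambda$ is a branch satisfying $(q^{\pm1}z)^\lambda=q^{\pm\lambda}z^\lambda$. The operator $L_1$ (one member of the Lax pair of the $q$-Painlevé equation of type $E_7^{(1)}$; $f,g$ are its dependent variables) is $$L_1=\frac{q(\kappa_1-\kappa_2)(g\kappa_2-\nu_5)(g\kappa_2-\nu_6)(g\kappa_2-\nu_7)(g\kappa_2-\nu_8)}{g\kappa_1\kappa_2^2(fg\kappa_2-\kappa_1)(g\kappa_2z-\kappa_1)}-\frac{q(\kappa_1-\kappa_2)(g\nu_1-1)(g\nu_2-1)(g\nu_3-1)(g\nu_4-1)}{g(fg-1)\kappa_1\nu_1\nu_2\nu_3\nu_4(gz-q)}$$ $$+\frac{(q\nu_1-z)(q\nu_2-z)(q\nu_3-z)(q\nu_4-z)\{(g\kappa_2z-\kappa_1q)-\kappa_1(gz-q)T_z^{-1}\}}{q\kappa_1\nu_1\nu_2\nu_3\nu_4(fq-z)z^2(q-gz)}$$ $$-\frac{q(\kappa_1-\nu_5z)(\kappa_1-\nu_6z)(\kappa_1-\nu_7z)(\kappa_1-\nu_8z)\{\kappa_1(gz-1)-(g\kappa_2z-\kappa_1)T_z\}}{\kappa_1^4(f-z)z^2(g\kappa_2z-\kappa_1)}.$$ The space of initial values of the $q$-Painlevé equation of type $E_7^{(1)}$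 is $\mathbb P^1\times\mathbb P^1$ (coordinates $(f,g)$) blown up at the eight points $P_1,\dots,P_8$: $(\nu_i,1/\nu_i)_{i=1,2,3,4}$, $(\kappa_1/\nu_i,\nu_i/\kappa_2)_{i=5,6,7,8}$. Each coordinate system $(f_1,g_1)$ in the claim is a chart of the blow-up at the indicated point, $g_1=0$ being the exceptional curve; $f_1$ is kept as a free parameter. Setting $g_1=0$ is done on the level of rational expressions in $z$, $f_1$, $g_1$ and the parameters: common factors, namely a power of $g_1$ and (after $g_1=0$) the factor $\kappa_1-\kappa_2$ occurring in both numerator and denominator of one term, are cancelled. The parameter $E$ in the degree-$4$ equation is called the accessory parameter. *)

(* Defs.v *)
(* MathComp, with the complex numbers R[i] over an R : realType. *)
From mathcomp Require Import all_boot all_order all_fingroup all_algebra.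
From mathcomp Require Import complex reals.
From mathcomp Require Import mpoly.
From mathcomp Require sequences trigo.

Set Implicit Arguments.
Unset Strict Implicit.
Unset Printing Implicit Defensive.

Import Order.TTheory GRing.Theory Num.Theory.
Local Open Scope ring_scope.

(* nu i is nu_{i+1} and mu i is nu_{i+5}, for i = 0, ..., 3. *)
Record params (F : Type) : Type := Params {
  q : F; k1 : F; k2 : F; nu : 'I_4 -> F; mu : 'I_4 -> F }.

Definition map_params (F G : Type) (phi : F -> G) (p : params F) : params G :=
  Params (phi (q p)) (phi (k1 p)) (phi (k2 p)) (phi \o nu p) (phi \o mu p).

(* Exchange of nu_1 with nu_{i+1}, resp. of nu_5 with nu_{i+5}. *)
Definition exch_nu (F : Type) (i : 'I_4) (p : params F) : params F :=
  Params (q p) (k1 p) (k2 p) (nu p \o tperm ord0 i) (mu p).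
Definition exch_mu (F : Type) (i : 'I_4) (p : params F) : params F :=
  Params (q p) (k1 p) (k2 p) (nu p) (mu p \o tperm ord0 i).

Section Formulas.
Variable F : fieldType.
Implicit Types (p : params F) (f g z x : F).

Definition admissible p : Prop :=
  [/\ q p != 0, k1 p != 0 & k2 p != 0] /\
  [/\ forall i, nu p i != 0, forall i, mu p i != 0 &
      k1 p ^+ 2 * k2 p ^+ 2 = q p * (\prod_i nu p i) * (\prod_i mu p i)].

(* L_1 y(z), where yp, ym, y0 stand for T_z y(z) = y(qz),
   T_z^{-1} y(z) = y(z/q) and y(z). *)
Definition L1 p f g z (yp ym y0 : F) : F :=
  let: Params q k1 k2 nu mu := p in
    q * (k1 - k2) * (\prod_i (g * k2 - mu i))
      / (g * k1 * k2 ^+ 2 * (f * g * k2 - k1) * (g * k2 * z - k1)) * y0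
  - q * (k1 - k2) * (\prod_i (g * nu i - 1))
      / (g * (f * g - 1) * k1 * (\prod_i nu i) * (g * z - q)) * y0
  + (\prod_i (q * nu i - z))
      / (q * k1 * (\prod_i nu i) * (f * q - z) * z ^+ 2 * (q - g * z))
      * ((g * k2 * z - k1 * q) * y0 - k1 * (g * z - q) * ym)
  - q * (\prod_i (k1 - mu i * z))
      / (k1 ^+ 4 * (f - z) * z ^+ 2 * (g * k2 * z - k1))
      * (k1 * (g * z - 1) * y0 - (g * k2 * z - k1) * yp).

(* The three-term equation at (nu_1, 1/nu_1). *)
Definition eqn_nu p (f1 z yp ym y0 : F) : F :=
  let: Params q k1 k2 nu mu := p in
  let n1 := nu ord0 in
    q * (\prod_i (k1 - mu i * z)) / (k1 ^+ 4 * (n1 - z) * z ^+ 2) * yp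
  + (\prod_(j | j != ord0) (q * nu j - z))
      / (q * (\prod_i nu i) * z ^+ 2) * ym
  + ( - (q * (k1 - k2) * (\prod_(j | j != ord0) (n1 - nu j))
          / (k1 * (f1 + n1 ^+ 2) * (\prod_(j | j != ord0) nu j) * (q * n1 - z)))
      + q * (\prod_i (k2 - n1 * mu i))
          / (k1 * k2 ^+ 2 * n1 ^+ 2 * (k1 * n1 - k2 * z))
      - (k1 * q * n1 - k2 * z) * (\prod_(j | j != ord0) (q * nu j - z))
          / (k1 * q * (\prod_i nu i) * (q * n1 - z) * z ^+ 2)
      - q * (\prod_i (k1 - mu i * z))
          / (k1 ^+ 3 * z ^+ 2 * (k1 * n1 - k2 * z)) ) * y0.

(* The three-term equation at (kappa_1/nu_5, nu_5/kappa_2). *)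
Definition eqn_mu p (f1 z yp ym y0 : F) : F :=
  let: Params q k1 k2 nu mu := p in
  let n5 := mu ord0 in
    q * n5 * (\prod_(j | j != ord0) (k1 - mu j * z)) / (k1 ^+ 4 * z ^+ 2) * yp
  + n5 * (\prod_i (q * nu i - z))
      / (q * (\prod_i nu i) * z ^+ 2 * (k1 * q - n5 * z)) * ym
  + ( - (q * (k1 - k2) * (\prod_(j | j != ord0) (n5 - mu j))
          / (k1 * (k1 * k2 + f1 * n5 ^+ 2) * (k1 - n5 * z)))
      - k2 * n5 * (\prod_i (q * nu i - z))
          / (q * k1 * (\prod_i nu i) * z ^+ 2 * (k2 * q - n5 * z))
      + q * (\prod_i (k2 - nu i * n5))
          / (k1 * k2 * (\prod_i nu i) * n5 * (k2 * q - n5 * z))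
      - q * n5 * (k2 - n5 * z) * (\prod_(j | j != ord0) (k1 - mu j * z))
          / (k1 ^+ 3 * k2 * z ^+ 2 * (k1 - n5 * z)) ) * y0.

(* The points z != 0 off the poles of the coefficients of eqn_nu, eqn_mu. *)
Definition regular_nu p z : Prop :=
  [/\ z != 0, nu p ord0 - z != 0, q p * nu p ord0 - z != 0 &
      k1 p * nu p ord0 - k2 p * z != 0].
Definition regular_mu p z : Prop :=
  [/\ z != 0, k1 p - mu p ord0 * z != 0, k1 p * q p - mu p ord0 * z != 0 &
      k2 p * q p - mu p ord0 * z != 0].

(* Left-hand side at x of the variant of the q-Heun equation of degree 4;
   s stands for q^{1/2} and r for (h_1 h_2 h_3 h_4 l_1 l_2 l_3 l_4)^{1/2}. *)
Definition qHeun4 (q s : F) (h l : 'I_4 -> F) (r E : F) (u : F -> F) x : F :=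
    (\prod_i (x - h i * s)) * u (x / q)
  + (\prod_i (x - l i * s^-1)) * u (q * x)
  + ( - ((s + s^-1) * x ^+ 4) + (\sum_i (h i + l i)) * x ^+ 3 + E * x ^+ 2
      + r * ((\sum_i ((h i)^-1 + (l i)^-1)) * x - (s + s^-1)) ) * u x.

Definition h_nu p (s : F) (i : 'I_4) : F :=
  if i == ord0 then s ^+ 3 * nu p i else s * nu p i.
Definition l_nu p (s : F) (i : 'I_4) : F := s * k1 p / mu p i.
Definition root_nu p : F := q p ^+ 3 * k1 p * (\prod_i nu p i) / k2 p.
Definition K1_nu p : F :=
  nu p ord0 * (k1 p - k2 p) * (\prod_(j | j != ord0) (nu p ord0 - nu p j)).
Definition K2_nu p : F :=
    k1 p * nu p ord0
      * ((- nu p ord0 + \sum_(j | j != ord0) nu p j) / k2 p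
         + \sum_i (mu p i)^-1)
  + (\prod_(j | j != ord0) nu p j)
      * (- (nu p ord0)^-1 + (\sum_(j | j != ord0) (nu p j)^-1)
         + (\sum_i mu p i) / k2 p).
Definition E_nu p (s f1 : F) : F :=
  - s ^+ 3 * (K1_nu p / (k2 p * (f1 + nu p ord0 ^+ 2)) + K2_nu p).

Definition h_mu p (s : F) (i : 'I_4) : F := s * nu p i.
Definition l_mu p (s : F) (i : 'I_4) : F :=
  if i == ord0 then k1 p / (s * mu p i) else s * k1 p / mu p i.
Definition root_mu p : F := q p ^+ 2 * k1 p * (\prod_i nu p i) / k2 p.
Definition K1_mu p : F :=
  q p * (\prod_i nu p i) * (k1 p - k2 p)
    * (\prod_(j | j != ord0) (mu p ord0 - mu p j)).
Definition K2_mu p : F :=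
    k1 p * k2 p / mu p ord0
      * ((\sum_i nu p i) / k2 p - (mu p ord0)^-1
         + \sum_(j | j != ord0) (mu p j)^-1)
  + q p * (\prod_i nu p i) * (mu p ord0 / k2 p)
      * ((\sum_i (nu p i)^-1)
         + (- mu p ord0 + \sum_(j | j != ord0) mu p j) / k2 p).
Definition E_mu p (s f1 : F) : F :=
  - s * (K1_mu p / (k2 p * mu p ord0 * (f1 * mu p ord0 ^+ 2 + k1 p * k2 p))
         + K2_mu p).

(* y solves the three-term equation at every point of Om where its coefficients
   are defined. *)
Definition solves (Om reg : F -> Prop) (q : F)
    (eqn : F -> F -> F -> F -> F) (y : F -> F) : Prop :=
  forall z, Om z -> reg z -> eqn z (y (q * z)) (y (z / q)) (y z) = 0.

End Formulas.

Section ExceptionalLine.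
Variable C : fieldType.

(* Rational expressions in q, kappa_1, kappa_2, nu_1, ..., nu_8, z, f_1
   (in this order), all of them independent indeterminates. *)
Definition ratexpr : fieldType := {fraction {mpoly C[13]}}.

Definition indet (k : nat) : ratexpr :=
  tofrac ('X_(inord k) : {mpoly C[13]}).
Definition cst (c : C) : ratexpr := tofrac (c%:MP : {mpoly C[13]}).

Definition gen_params : params ratexpr :=
  Params (indet 0) (indet 1) (indet 2)
         (fun i => indet (3 + i)) (fun i => indet (7 + i)).
Definition gen_z : ratexpr := indet 11.
Definition gen_f1 : ratexpr := indet 12.

(* Rational expressions in which g_1 may also occur. *)
Definition ratexpr_g1 : fieldType := {fraction {poly ratexpr}}.
Definition g1 : ratexpr_g1 := tofrac 'X.
Definition lift (r : ratexpr) : ratexpr_g1 := tofrac r%:P.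

(* r0 is the value of r at g_1 = 0 once the common powers of g_1 have been
   cancelled. *)
Definition set_g1_0 (r : ratexpr_g1) (r0 : ratexpr) : Prop :=
  exists N D : {poly ratexpr},
    [/\ D.[0] != 0, r = tofrac N / tofrac D & r0 = N.[0] / D.[0]].

(* The rational expression r0, in some representation as a fraction, is defined
   at the numerical values p, z, f1, and takes the value c there. *)
Definition evaluates_to (r0 : ratexpr) (p : params C) (z f1 c : C) : Prop :=
  let v (k : 'I_13) : C :=
    nth 0 ([:: q p; k1 p; k2 p] ++ codom (nu p) ++ codom (mu p) ++ [:: z; f1])
        k in
  exists N D : {mpoly C[13]},
    [/\ D.@[v] != 0, r0 = tofrac N / tofrac D &
        c = N.@[v] / D.@[v]].

(* (f, g) is the point of the chart (f_1, g_1), in terms of the indeterminates.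
   Substituting it into L_1 y(z), setting g_1 = 0 and cancelling, and only then
   giving their numerical values to the parameters, z and f_1, yields eqn.  The
   order matters when kappa_1 = kappa_2. *)
Definition restricts_to (f g : ratexpr_g1) (p : params C) (f1 z : C)
    (eqn : C -> C -> C -> C) : Prop :=
  forall yp ym y0 : C, exists r0 : ratexpr,
    set_g1_0 (L1 (map_params lift gen_params) f g (lift gen_z)
                 (lift (cst yp)) (lift (cst ym)) (lift (cst y0))) r0
    /\ evaluates_to r0 p z f1 (eqn yp ym y0).

(* The chart at P_{i+1} = (nu_{i+1}, 1/nu_{i+1}). *)
Definition chart_nu_f (i : 'I_4) : ratexpr_g1 :=
  lift gen_f1 * g1 + lift (nu gen_params i).
Definition chart_nu_g (i : 'I_4) : ratexpr_g1 :=
  g1 + (lift (nu gen_params i))^-1.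

(* The chart at P_{i+5} = (kappa_1/nu_{i+5}, nu_{i+5}/kappa_2). *)
Definition chart_mu_f (i : 'I_4) : ratexpr_g1 :=
  lift gen_f1 * g1 + lift (k1 gen_params) / lift (mu gen_params i).
Definition chart_mu_g (i : 'I_4) : ratexpr_g1 :=
  g1 + lift (mu gen_params i) / lift (k2 gen_params).

End ExceptionalLine.

Section Powers.
Variable R : realType.
Local Notation C := (complex R).

Definition cexp (w : C) : C :=
  Complex (sequences.expR (complex.Re w) * trigo.cos (complex.Im w))
          (sequences.expR (complex.Re w) * trigo.sin (complex.Im w)).

Definition q_stable (q : C) (Om : C -> Prop) : Prop :=
  forall z, Om z -> [/\ z != 0, Om (q * z) & Om (z / q)].

(* P is a branch of z^lam on Om with (q^{+-1} z)^lam = q^{+-lam} z^lam, where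
   q^lam = exp (lam * lq) for the logarithm lq of q.  Continuity is not
   required. *)
Definition power_branch (q lq lam : C) (Om : C -> Prop) (P : C -> C) : Prop :=
  forall z, Om z ->
    [/\ exists2 w, cexp w = z & P z = cexp (lam * w),
        P (q * z) = cexp (lam * lq) * P z &
        P (z / q) = cexp (- (lam * lq)) * P z].

End Powers.

(* Main.v *)
Require Import Defs.
From mathcomp Require Import all_boot all_order all_fingroup all_algebra.
From mathcomp Require Import complex reals.
From mathcomp Require Import mpoly ring.
Import Order.TTheory GRing.Theory Num.Theory.
Local Open Scope ring_scope.

Set Implicit Arguments.
Unset Strict Implicit.
Unset Printing Implicit Defensive.

(* Setting g_1 = 0 and then evaluating numerically is a place of the field of
   rational expressions: a partial map compatible with the field operations. The
   value of L_1 is thus found factor by factor, once each term is rewritten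
   without a pole at g_1 = 0. One factor stays indeterminate if evaluated at once
   at numbers with kappa_1 = kappa_2: (kappa_1 - kappa_2) / (f g kappa_2 - kappa_1)
   at P_1, resp. (kappa_1 - kappa_2) / (f g - 1) at P_5; at g_1 = 0 these become
   -1, resp. kappa_2, while the parameters are still generic.

   The degree 4 equation is a multiple of the three-term equation. The parameters
   that the statement treats symmetrically enter the comparison of coefficients
   only through their elementary symmetric functions, the last of which is
   eliminated by kappa_1^2 kappa_2^2 = q nu_1 ... nu_8. *)

(** * Places between fields and their composition *)

(** A relation rather than a function, since an element with a pole has no value. [place0_eq]
    already makes values unique: if [a] has the values [x] and [y], then [a - a = 0] has the value
    [x - y]. *)
Record place (K L : fieldType) (ev : K -> L -> Prop) : Prop := Place {
  place1 : ev 1 1;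
  placeN : forall a x, ev a x -> ev (- a) (- x);
  placeD : forall a b x y, ev a x -> ev b y -> ev (a + b) (x + y);
  placeM : forall a b x y, ev a x -> ev b y -> ev (a * b) (x * y);
  placeV : forall a x, x != 0 -> ev a x -> ev a^-1 x^-1;
  place0_eq : forall x, ev 0 x -> x = 0 }.

Section Place.
Variables (K L : fieldType) (ev : K -> L -> Prop) (evP : place ev).

Lemma place0 : ev 0 0.
Proof.
have := placeD evP (place1 evP) (placeN evP (place1 evP)).
by rewrite !subrr.
Qed.

(** This turns hypotheses on numerical values into the non-vanishing of rational expressions, hence
    into the right to divide in [K]. *)
Lemma place_neq0 a x : ev a x -> x != 0 -> a != 0.
Proof. by move=> ax x0; apply: contra_neq x0 => a0; apply: (place0_eq evP); rewrite -a0. Qed.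

Lemma placeB a b x y : ev a x -> ev b y -> ev (a - b) (x - y).
Proof. by move=> ax bY; apply: (placeD evP) => //; apply: (placeN evP). Qed.

Lemma place_div a b x y : y != 0 -> ev a x -> ev b y -> ev (a / b) (x / y).
Proof. by move=> y0 ax bY; apply: (placeM evP) => //; apply: (placeV evP). Qed.

Lemma placeX a x n : ev a x -> ev (a ^+ n) (x ^+ n).
Proof.
move=> ax; elim: n => [|n IHn]; first exact: (place1 evP).
by rewrite !exprS; apply: (placeM evP).
Qed.

Lemma place_prod (I : Type) (r : seq I) (P : pred I) (A : I -> K) (X : I -> L) :
  (forall i, P i -> ev (A i) (X i)) ->
  ev (\prod_(i <- r | P i) A i) (\prod_(i <- r | P i) X i).
Proof.
move=> h; apply: (big_ind2 (fun a x => ev a x)) => //; first exact: (place1 evP).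
by move=> *; apply: (placeM evP).
Qed.

End Place.

(** Specialisation happens in two stages, first [g_1 = 0] and then numbers; the composite lets a
    term be carried through both at once. *)
Lemma place_comp (K L M : fieldType) (ev1 : K -> L -> Prop) (ev2 : L -> M -> Prop) :
  place ev1 -> place ev2 ->
  place (fun a c => exists x, ev1 a x /\ ev2 x c).
Proof.
move=> P1 P2; split.
- by exists 1; split; [exact: (place1 P1)|exact: (place1 P2)].
- move=> a c [x [ax xc]]; exists (- x).
  by split; [exact: (placeN P1)|exact: (placeN P2)].
- move=> a b c d [x [ax xc]] [y [bY yd]]; exists (x + y).
  by split; [exact: (placeD P1)|exact: (placeD P2)].
- move=> a b c d [x [ax xc]] [y [bY yd]]; exists (x * y).
  by split; [exact: (placeM P1)|exact: (placeM P2)].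
(* A non-zero final value forces the intermediate [x] to be non-zero, so the first place may invert
   as well. *)
- move=> a c c0 [x [ax xc]]; exists x^-1.
  by split; [apply: (placeV P1) => //; exact: (place_neq0 P2 xc)|exact: (placeV P2)].
- move=> c [x [ax xc]]; apply: (place0_eq P2).
  by rewrite -(place0_eq P1 ax).
Qed.

(** * Evaluation of fractions along a ring morphism *)

Section FracPlace.
Variables (A : idomainType) (L : fieldType) (phi : {rmorphism A -> L}).

(** The residue map of the localization of [A] at the kernel of [phi]. Asking for one good
    representative is what cancelling common factors means. [set_g1_0] and [evaluates_to] are the
    instances at [horner_eval 0] and [meval v]. *)
Definition frac_eval (a : {fraction A}) (x : L) : Prop :=
  exists N D : A, [/\ phi D != 0, a = tofrac N / tofrac D & x = phi N / phi D].

Lemma frac_evalE N : frac_eval (tofrac N) (phi N).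
Proof. by exists N, 1; rewrite !rmorph1 !divr1 oner_neq0. Qed.

Lemma frac_eval_place : place frac_eval.
Proof.
have nz D : phi D != 0 -> tofrac D != 0.
  by rewrite tofrac_eq0; apply: contra_neq => ->; rewrite rmorph0.
split.
- by rewrite -(rmorph1 (@tofrac A)) -[X in frac_eval _ X](rmorph1 phi); exact: frac_evalE.
- move=> _ _ [N [D [D0 -> ->]]]; exists (- N), D.
  by rewrite !rmorphN !mulNr.
- move=> _ _ _ _ [N [D [D0 -> ->]]] [N' [D' [D0' -> ->]]].
  exists (N * D' + N' * D), (D * D').
  by rewrite !rmorphD !rmorphM mulf_neq0 // !addf_div ?nz.
- move=> _ _ _ _ [N [D [D0 -> ->]]] [N' [D' [D0' -> ->]]].
  exists (N * N'), (D * D').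
  by rewrite !rmorphM mulf_neq0 // !mulf_div.
(* The inverse is represented by [D / N], where [phi N] is non-zero because [x] is. *)
- move=> a x x0 [N [D [D0 -> xE]]]; exists D, N; rewrite xE !invf_div.
  by split=> //; apply: contra_neq x0; rewrite xE => ->; rewrite mul0r.
- move=> x [N [D [D0 /eqP + ->]]]; rewrite eq_sym mulf_eq0 invr_eq0.
  by rewrite (negPf (nz _ D0)) orbF tofrac_eq0 => /eqP ->; rewrite rmorph0 mul0r.
Qed.

End FracPlace.

(** * Symmetry of the operator in the parameters *)

Section Exchange.
Variables (F : fieldType) (p : params F) (i : 'I_4).

Lemma prod_tperm (G : 'I_4 -> F) : \prod_j G (tperm ord0 i j) = \prod_j G j.
Proof. by rewrite [RHS](reindex_inj (@perm_inj _ (tperm ord0 i))). Qed.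

(** The nu_1, ..., nu_4 enter [L1] only through products over all four indices. This reduces the
    points P_2, P_3, P_4 to P_1 with exchanged parameters. *)
Lemma L1_exch_nu : L1 (exch_nu i p) = L1 p.
Proof.
case: p => q0 a b n m; rewrite /L1 /exch_nu /= (prod_tperm n).
apply/boolp.funext => f; apply/boolp.funext => g; apply/boolp.funext => z.
by rewrite (prod_tperm (fun j => g * n j - 1)) (prod_tperm (fun j => q0 * n j - z)).
Qed.

Lemma L1_exch_mu : L1 (exch_mu i p) = L1 p.
Proof.
case: p => q0 a b n m; rewrite /L1 /exch_mu /=.
apply/boolp.funext => f; apply/boolp.funext => g; apply/boolp.funext => z.
by rewrite (prod_tperm (fun j => g * b - m j)) (prod_tperm (fun j => a - m j * z)).
Qed.

Lemma admissible_exch_nu : admissible p -> admissible (exch_nu i p).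
Proof.
case=> h [hn hm e]; split=> //; split=> //=.
by rewrite (prod_tperm (nu p)).
Qed.

Lemma admissible_exch_mu : admissible p -> admissible (exch_mu i p).
Proof.
case=> h [hn hm e]; split=> //; split=> //=.
by rewrite (prod_tperm (mu p)).
Qed.

End Exchange.

Definition ev_params (K L : Type) (ev : K -> L -> Prop) (P : params K) (p : params L) :=
  [/\ ev (q P) (q p), ev (k1 P) (k1 p), ev (k2 P) (k2 p),
      forall i, ev (nu P i) (nu p i) & forall i, ev (mu P i) (mu p i)].

Lemma bigD0 (F : fieldType) (G : 'I_4 -> F) : \prod_i G i = G ord0 * \prod_(i | i != ord0) G i.
Proof. by rewrite (bigD1 ord0). Qed.

Lemma prod4_mull (F : fieldType) (c : F) (G : 'I_4 -> F) :
  \prod_i (c * G i) = c ^+ 4 * \prod_i G i.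
Proof. by rewrite big_split /= prodr_const card_ord. Qed.

Lemma prod3_mull (F : fieldType) (c : F) (G : 'I_4 -> F) :
  \prod_(i | i != ord0) (c * G i) = c ^+ 3 * \prod_(i | i != ord0) G i.
Proof. by rewrite big_split /= prodr_const cardC1 card_ord. Qed.

(** * The value of [L1] at a place where the chart coordinate [G] has value 0 *)

Section L1Limit.
Variables (K C : fieldType) (ev : K -> C -> Prop) (evP : place ev).
Variables (P : params K) (p : params C) (ePp : ev_params ev P p).
Hypothesis hp : [/\ q p != 0, k1 p != 0, k2 p != 0,
   forall i, nu p i != 0 & forall i, mu p i != 0].
Variables (F1 G Z Yp Ym Y0 : K) (f1 z yp ym y0 : C).
Hypotheses (eF1 : ev F1 f1) (eG : ev G 0) (eZ : ev Z z) (eYp : ev Yp yp) (eYm : ev Ym ym)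
  (eY0 : ev Y0 y0) (G0 : G != 0).

Let N1 := nu P ord0.
Let N5 := mu P ord0.

(** Division is tried before multiplication because inverses have no rule of their own. What may
    remain is the non-vanishing of values of denominators, and isolated inverses. *)
Ltac ev_auto := repeat first
  [ assumption | match goal with h : forall i, ev _ _ |- _ => exact: h end
  | apply: (placeB evP) | apply: (placeD evP) | apply: (placeN evP)
  | apply: (place_div evP)
  | apply: (placeM evP) | apply: (placeX evP)
  | exact: (place1 evP) | (apply: (place_prod evP); move=> ? ?) ].

(** Both [f * g - 1] and [g * nu_1 - 1] carry a factor [G], which cancels. The one quotient that may
    read 0/0 numerically is supplied as a hypothesis, so kappa_1 = kappa_2 stays allowed. *)
Lemma ev_L1_nu :
  let f := F1 * G + N1 in let g := G + N1^-1 in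
  ev ((k1 P - k2 P) / (f * g * k2 P - k1 P)) (- 1) ->
  f1 + nu p ord0 ^+ 2 != 0 -> regular_nu p z ->
  ev (L1 P f g Z Yp Ym Y0) (eqn_nu p f1 z yp ym y0).
Proof.
move=> f g; rewrite {}/f {}/g /regular_nu {}/N1.
case: P ePp => qK aK bK nK mK [/=]; case: p hp => q0 a b n m [/=].
move=> q0n an bn nn mn eq ea eb en em.
set n1 := n ord0; set n1K := nK ord0 => ew X0 [z0 nz0 qnz0 abz0].
have n10 : n1 != 0 by exact: nn.
have en1 : ev n1K n1 by exact: en.
have en1V : ev n1K^-1 n1^-1 by exact: (placeV evP).
have n1K0 : n1K != 0 by exact: (place_neq0 evP en1).
set f := F1 * G + n1K in ew *; set g := G + n1K^-1 in ew *.
set w := (aK - bK) / _ in ew.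
(* The value is expanded to [f1 * 0 + n1] to copy the shape of [f]. *)
have ef : ev f n1 by rewrite -[n1]add0r -[X in X + n1](mulr0 f1) /f; ev_auto.
have eg : ev g n1^-1 by rewrite -[n1^-1]add0r /g; ev_auto.
(* [h] is [(f * g - 1) / G]; its value is non-zero by [X0]. *)
pose h := F1 / n1K + n1K + F1 * G.
have eh : ev h ((f1 + n1 ^+ 2) / n1).
  have -> : (f1 + n1 ^+ 2) / n1 = f1 / n1 + n1 + f1 * 0 by field.
  by rewrite /h; ev_auto.
have h0 : h != 0 by apply: (place_neq0 evP eh); rewrite mulf_neq0 ?invr_eq0.
have fgE : f * g - 1 = G * h by rewrite /f /g /h; field.
have g0 : n1^-1 != 0 by rewrite invr_eq0.
have r1 : n1^-1 * b * z - a != 0.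
  have -> : n1^-1 * b * z - a = - (a * n1 - b * z) / n1 by field.
  by rewrite mulf_neq0 ?oppr_eq0.
have r2 : n1^-1 * z - q0 != 0.
  have -> : n1^-1 * z - q0 = - (q0 * n1 - z) / n1 by field.
  by rewrite mulf_neq0 ?oppr_eq0.
have r3 : q0 - n1^-1 * z != 0 by rewrite -oppr_eq0 opprB.
have r4 : n1 * q0 - z != 0 by rewrite mulrC.
have pn0 : \prod_i n i != 0 by apply/prodf_neq0 => i _; apply: nn.
have pn'0 : \prod_(i | i != ord0) n i != 0 by apply/prodf_neq0 => i _; apply: nn.
suff : ev (L1 (Params qK aK bK nK mK) f g Z Yp Ym Y0)
    (eqn_nu (Params q0 a b n m) f1 z yp ym y0) by [].
(* A form of [L1] with no factor [G] left in a denominator and the delicate quotient isolated as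
   [w]. *)
have -> : L1 (Params qK aK bK nK mK) f g Z Yp Ym Y0 =
    qK * w * (\prod_i (g * bK - mK i)) / (g * aK * bK ^+ 2 * (g * bK * Z - aK)) * Y0
  - qK * (aK - bK) * n1K * (\prod_(i | i != ord0) (g * nK i - 1))
      / (g * h * aK * (\prod_i nK i) * (g * Z - qK)) * Y0
  + (\prod_i (qK * nK i - Z))
      / (qK * aK * (\prod_i nK i) * (f * qK - Z) * Z ^+ 2 * (qK - g * Z))
      * ((g * bK * Z - aK * qK) * Y0 - aK * (g * Z - qK) * Ym)
  - qK * (\prod_i (aK - mK i * Z))
      / (aK ^+ 4 * (f - Z) * Z ^+ 2 * (g * bK * Z - aK))
      * (aK * (g * Z - 1) * Y0 - (g * bK * Z - aK) * Yp).
  rewrite /L1; congr (_ - _ + _ - _).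
    rewrite /w; set A := \prod_i _; rewrite !invfM; ring.
  rewrite fgE (bigD0 (fun i => g * nK i - 1)) -/n1K.
  have -> : g * n1K - 1 = G * n1K by rewrite /g; field.
  set A := \prod_(i | _) _; set B := \prod_i _.
  (* All inverses except that of [G] become variables: only the cancellation of [G] is left. *)
  rewrite !invfM; move: B^-1 g^-1 h^-1 aK^-1 (g * Z - qK)^-1 => i1 i2 i3 i4 i5.
  by field.
(* The target takes the same shape, with every factor replaced by its value. *)
have -> : eqn_nu (Params q0 a b n m) f1 z yp ym y0 =
    q0 * (- 1) * (\prod_i (n1^-1 * b - m i)) / (n1^-1 * a * b ^+ 2 * (n1^-1 * b * z - a)) * y0
  - q0 * (a - b) * n1 * (\prod_(i | i != ord0) (n1^-1 * n i - 1))
      / (n1^-1 * ((f1 + n1 ^+ 2) / n1) * a * (\prod_i n i) * (n1^-1 * z - q0)) * y0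
  + (\prod_i (q0 * n i - z))
      / (q0 * a * (\prod_i n i) * (n1 * q0 - z) * z ^+ 2 * (q0 - n1^-1 * z))
      * ((n1^-1 * b * z - a * q0) * y0 - a * (n1^-1 * z - q0) * ym)
  - q0 * (\prod_i (a - m i * z))
      / (a ^+ 4 * (n1 - z) * z ^+ 2 * (n1^-1 * b * z - a))
      * (a * (n1^-1 * z - 1) * y0 - (n1^-1 * b * z - a) * yp).
  have -> : \prod_i (n1^-1 * b - m i) = n1^-1 ^+ 4 * \prod_i (b - n1 * m i).
    by rewrite -prod4_mull; apply: eq_bigr => i _; field.
  have -> : \prod_(i | i != ord0) (n1^-1 * n i - 1)
      = (- n1^-1) ^+ 3 * \prod_(i | i != ord0) (n1 - n i).
    by rewrite -prod3_mull; apply: eq_bigr => i _; field.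
  rewrite /eqn_nu (bigD0 (fun i => q0 * n i - z)) (bigD0 n) -/n1.
  move: (\prod_(i | i != ord0) n i) pn'0 (\prod_(i | i != ord0) (n1 - n i)).
  move: (\prod_(i | i != ord0) _) (\prod_i (b - _)) (\prod_i _) => A B D E E0 H.
  field.
  have r5 : b * z + - a * n1 != 0 by rewrite mulNr -oppr_eq0 opprB.
  have r6 : z + - q0 * n1 != 0 by rewrite mulNr -oppr_eq0 opprB.
  by rewrite E0 n10 an bn X0 z0 nz0 qnz0 abz0 q0n r5 r6.
ev_auto; rewrite ?mulf_neq0 ?expf_neq0 ?invr_eq0 //.
Qed.

(** The two denominators trade roles: now [f * g * k2 - k1] carries the factor [G], cancelled by
    [g * k2 - nu_5 = G * k2], while [f * g - 1] is the one paired with kappa_1 - kappa_2. *)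
Lemma ev_L1_mu :
  let f := F1 * G + k1 P / N5 in let g := G + N5 / k2 P in
  ev ((k1 P - k2 P) / (f * g - 1)) (k2 p) ->
  f1 * mu p ord0 ^+ 2 + k1 p * k2 p != 0 -> regular_mu p z ->
  ev (L1 P f g Z Yp Ym Y0) (eqn_mu p f1 z yp ym y0).
Proof.
move=> f g; rewrite {}/f {}/g /regular_mu {}/N5.
case: P ePp => qK aK bK nK mK [/=]; case: p hp => q0 a b n m [/=].
move=> q0n an bn nn mn eq ea eb en em.
set m5 := m ord0; set m5K := mK ord0 => ew X0 [z0 amz0 aqmz0 bqmz0].
have m50 : m5 != 0 by exact: mn.
have em5 : ev m5K m5 by exact: em.
have m5K0 : m5K != 0 by exact: (place_neq0 evP em5).
have bK0 : bK != 0 by exact: (place_neq0 evP eb).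
set f := F1 * G + aK / m5K in ew *; set g := G + m5K / bK in ew *.
set w := (aK - bK) / _ in ew.
have ef : ev f (a / m5) by rewrite -[a / m5]add0r -[X in X + _](mulr0 f1) /f; ev_auto.
have eg : ev g (m5 / b) by rewrite -[m5 / b]add0r /g; ev_auto.
(* [h] is [(f * g * k2 - k1) / G]. *)
pose h := F1 * m5K + aK * bK / m5K + F1 * bK * G.
have eh : ev h ((f1 * m5 ^+ 2 + a * b) / m5).
  have -> : (f1 * m5 ^+ 2 + a * b) / m5 = f1 * m5 + a * b / m5 + f1 * b * 0 by field.
  by rewrite /h; ev_auto.
have h0 : h != 0 by apply: (place_neq0 evP eh); rewrite mulf_neq0 ?invr_eq0.
have fgE : f * g * bK - aK = G * h by rewrite /f /g /h; field; rewrite m5K0.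
have g0 : m5 / b != 0 by rewrite mulf_neq0 ?invr_eq0.
have r1 : m5 * z - a != 0 by rewrite -oppr_eq0 opprB.
have r1' : m5 / b * b * z - a != 0 by rewrite divfK.
have r2 : m5 / b * z - q0 != 0.
  have -> : m5 / b * z - q0 = - (b * q0 - m5 * z) / b by field.
  by rewrite mulf_neq0 ?oppr_eq0 ?invr_eq0.
have r3 : q0 - m5 / b * z != 0 by rewrite -oppr_eq0 opprB.
have r4 : a / m5 * q0 - z != 0.
  have -> : a / m5 * q0 - z = (a * q0 - m5 * z) / m5 by field.
  by rewrite mulf_neq0 ?invr_eq0.
have r5 : a / m5 - z != 0.
  have -> : a / m5 - z = (a - m5 * z) / m5 by field.
  by rewrite mulf_neq0 ?invr_eq0.
have pn0 : \prod_i n i != 0 by apply/prodf_neq0 => i _; apply: nn.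
suff : ev (L1 (Params qK aK bK nK mK) f g Z Yp Ym Y0)
    (eqn_mu (Params q0 a b n m) f1 z yp ym y0) by [].
have -> : L1 (Params qK aK bK nK mK) f g Z Yp Ym Y0 =
    qK * (aK - bK) * bK * (\prod_(i | i != ord0) (g * bK - mK i))
      / (g * aK * bK ^+ 2 * h * (g * bK * Z - aK)) * Y0
  - qK * w * (\prod_i (g * nK i - 1)) / (g * aK * (\prod_i nK i) * (g * Z - qK)) * Y0
  + (\prod_i (qK * nK i - Z))
      / (qK * aK * (\prod_i nK i) * (f * qK - Z) * Z ^+ 2 * (qK - g * Z))
      * ((g * bK * Z - aK * qK) * Y0 - aK * (g * Z - qK) * Ym)
  - qK * (\prod_i (aK - mK i * Z))
      / (aK ^+ 4 * (f - Z) * Z ^+ 2 * (g * bK * Z - aK))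
      * (aK * (g * Z - 1) * Y0 - (g * bK * Z - aK) * Yp).
  rewrite /L1; congr (_ - _ + _ - _); last first.
    by rewrite /w; set A := \prod_i (_ - 1); rewrite !invfM; ring.
  rewrite fgE (bigD0 (fun i => g * bK - mK i)) -/m5K.
  have -> : g * bK - m5K = G * bK by rewrite /g; field.
  set A := \prod_(i | _) _.
  rewrite !invfM; move: g^-1 h^-1 aK^-1 bK^-1 (g * bK * Z - aK)^-1 => i1 i2 i3 i4 i5.
  by field.
have -> : eqn_mu (Params q0 a b n m) f1 z yp ym y0 =
    q0 * (a - b) * b * (\prod_(i | i != ord0) (m5 / b * b - m i))
      / (m5 / b * a * b ^+ 2 * ((f1 * m5 ^+ 2 + a * b) / m5) * (m5 / b * b * z - a)) * y0
  - q0 * b * (\prod_i (m5 / b * n i - 1))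
      / (m5 / b * a * (\prod_i n i) * (m5 / b * z - q0)) * y0
  + (\prod_i (q0 * n i - z))
      / (q0 * a * (\prod_i n i) * (a / m5 * q0 - z) * z ^+ 2 * (q0 - m5 / b * z))
      * ((m5 / b * b * z - a * q0) * y0 - a * (m5 / b * z - q0) * ym)
  - q0 * (\prod_i (a - m i * z))
      / (a ^+ 4 * (a / m5 - z) * z ^+ 2 * (m5 / b * b * z - a))
      * (a * (m5 / b * z - 1) * y0 - (m5 / b * b * z - a) * yp).
  have -> : \prod_i (m5 / b * n i - 1) = (- b^-1) ^+ 4 * \prod_i (b - n i * m5).
    by rewrite -prod4_mull; apply: eq_bigr => i _; field.
  rewrite divfK // /eqn_mu (bigD0 (fun i => a - m i * z)) -/m5.
  move: (\prod_i n i) pn0 (\prod_(i | i != ord0) (m5 - m i)).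
  move: (\prod_(i | i != ord0) _) (\prod_i (b - _)) (\prod_i _) => A B D E E0 H.
  field.
  have s1 : a + - z * m5 != 0 by rewrite mulNr [z * _]mulrC.
  have s2 : a * q0 + - z * m5 != 0 by rewrite mulNr [z * _]mulrC.
  have s3 : q0 * b - m5 * z != 0 by rewrite [q0 * _]mulrC.
  have s4 : m5 * z + - q0 * b != 0 by rewrite mulNr -oppr_eq0 opprB.
  by rewrite bn m50 r1 z0 s1 an s3 s2 E0 q0n s4 X0.
ev_auto; rewrite ?mulf_neq0 ?expf_neq0 ?invr_eq0 //.
Qed.

(** At [G = 0] one has [f * g = 1], so the denominator becomes kappa_2 - kappa_1. Meant for the
    first stage, where the values are still indeterminates and hence distinct. *)
Lemma ev_cancel_nu :
  k1 p != k2 p ->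
  ev ((k1 P - k2 P) / ((F1 * G + N1) * (G + N1^-1) * k2 P - k1 P)) (- 1).
Proof.
case: hp ePp => q0n an bn nn mn [eq ea eb en em] ab.
have en1 : ev N1 (nu p ord0) by exact: en.
have -> : - 1 = (k1 p - k2 p)
    / ((f1 * 0 + nu p ord0) * (0 + (nu p ord0)^-1) * k2 p - k1 p).
  by field; rewrite nn subr_eq0 eq_sym ab.
ev_auto.
- by rewrite mulr0 !add0r mulfV // mul1r subr_eq0 eq_sym.
- exact: (placeV evP).
Qed.

(** At [G = 0] one has [f * g = k1 / k2], so the denominator becomes [(k1 - k2) / k2]. *)
Lemma ev_cancel_mu :
  k1 p != k2 p ->
  ev ((k1 P - k2 P) / ((F1 * G + k1 P / N5) * (G + N5 / k2 P) - 1)) (k2 p).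
Proof.
case: hp ePp => q0n an bn nn mn [eq ea eb en em] ab.
have en5 : ev N5 (mu p ord0) by exact: em.
have nz : k1 p - k2 p != 0 by rewrite subr_eq0.
have e0 : (f1 * 0 + k1 p / mu p ord0) * (0 + mu p ord0 / k2 p) - 1 = (k1 p - k2 p) / k2 p.
  by field; rewrite bn mn.
have ve : (k1 p - k2 p)
    / ((f1 * 0 + k1 p / mu p ord0) * (0 + mu p ord0 / k2 p) - 1) = k2 p.
  by rewrite e0; field; rewrite nz bn.
rewrite -[X in ev _ X]ve.
ev_auto; rewrite ?e0 ?mulf_neq0 ?invr_eq0 //.
Qed.

End L1Limit.

(** * Setting [g_1 = 0] and evaluating at numbers are places; values of the generators *)

Section Restriction.
Variables (C : fieldType) (p : params C) (f1 z : C).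

Let v (k : 'I_13) : C :=
  nth 0 ([:: q p; k1 p; k2 p] ++ codom (nu p) ++ codom (mu p) ++ [:: z; f1]) k.

Let ev1 := @set_g1_0 C.
Let ev2 (r0 : ratexpr C) (c : C) := evaluates_to r0 p z f1 c.

Lemma set_g1_0_place : place ev1.
Proof. exact: (frac_eval_place (horner_eval (0 : ratexpr C))). Qed.

Lemma evaluates_to_place : place ev2.
Proof. exact: (frac_eval_place (meval v)). Qed.

Lemma set_g1_0_lift r : ev1 (Defs.lift r) r.
Proof.
have := frac_evalE (horner_eval (0 : ratexpr C)) r%:P.
by rewrite /= horner_evalE hornerC.
Qed.

Lemma set_g1_0_g1 : ev1 (g1 C) 0.
Proof.
have := frac_evalE (horner_eval (0 : ratexpr C)) 'X.
by rewrite /= horner_evalE hornerX.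
Qed.

Lemma g1_neq0 : g1 C != 0.
Proof. by rewrite tofrac_eq0 polyX_eq0. Qed.

Lemma evaluates_to_cst c : ev2 (cst c) c.
Proof. by have := frac_evalE (meval v) c%:MP; rewrite /= mevalC. Qed.

Lemma evaluates_to_indet k : ev2 (indet C k) (v (inord k)).
Proof. by have := frac_evalE (meval v) 'X_(inord k); rewrite /= mevalXU. Qed.

Lemma nth_catr (s1 s2 : seq C) k : nth 0 (s1 ++ s2) (size s1 + k) = nth 0 s2 k.
Proof. by rewrite nth_cat ltnNge leq_addr /= addKn. Qed.

Lemma nth_codom_ord (n : nat) (G : 'I_n -> C) (j : 'I_n) : nth 0 (codom G) j = G j.
Proof. by rewrite codomE (nth_map j) ?size_enum_ord // nth_ord_enum. Qed.

Lemma evaluates_to_z : ev2 (gen_z C) z.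
Proof.
have := evaluates_to_indet 11.
by rewrite /v inordK // !nth_cat /= !size_codom card_ord.
Qed.

Lemma evaluates_to_f1 : ev2 (gen_f1 C) f1.
Proof.
have := evaluates_to_indet 12.
by rewrite /v inordK // !nth_cat /= !size_codom card_ord.
Qed.

Lemma evaluates_to_gen : ev_params ev2 (gen_params C) p.
Proof.
split=> /=.
- by have := evaluates_to_indet 0; rewrite /v inordK.
- by have := evaluates_to_indet 1; rewrite /v inordK.
- by have := evaluates_to_indet 2; rewrite /v inordK.
- move=> j; have := evaluates_to_indet (3 + j).
  (* Layout of the 13 variables: three scalars, nu from 3 to 6, mu from 7 to 10, then z and f_1. The
     bound keeps [inord] from truncating. *)
  rewrite /v inordK; last by rewrite (@leq_trans 7) // (ltn_add2l 3 j 4).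
  rewrite -[(3 + j)%N]/(size [:: q p; k1 p; k2 p] + j)%N nth_catr.
  by rewrite nth_cat size_codom card_ord ltn_ord nth_codom_ord.
- move=> j; have := evaluates_to_indet (7 + j).
  rewrite /v inordK; last by rewrite (@leq_trans 11) // (ltn_add2l 7 j 4).
  have -> : (7 + j = size [:: q p; k1 p; k2 p] + (size (codom (nu p)) + j))%N.
    by rewrite size_codom card_ord.
  by rewrite !nth_catr nth_cat !size_codom card_ord ltn_ord nth_codom_ord.
Qed.

Lemma place_restriction :
  place (fun r c => exists r0, ev1 r r0 /\ ev2 r0 c).
Proof. exact: (place_comp set_g1_0_place evaluates_to_place). Qed.

Lemma restriction_gen :
  ev_params (fun r c => exists r0, ev1 r r0 /\ ev2 r0 c)
    (map_params (@Defs.lift C) (gen_params C)) p.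
Proof.
have [eq ea eb en em] := evaluates_to_gen.
by split=> [||| j | j]; eexists; split; try exact: set_g1_0_lift.
Qed.

Lemma set_g1_0_gen :
  ev_params ev1 (map_params (@Defs.lift C) (gen_params C)) (gen_params C).
Proof. by split=> *; exact: set_g1_0_lift. Qed.

End Restriction.

(** Evaluation with the [j]-th variable at 1 and all others at 0 separates the two
    indeterminates. *)
Lemma indet_inj (C : fieldType) j k :
  (j < 13)%N -> (k < 13)%N -> indet C j = indet C k -> j = k.
Proof.
move=> j13 k13 /eqP; rewrite tofrac_eq => /eqP /(congr1 (meval (fun i => (i == inord j)%:R))).
rewrite !mevalXU eqxx; case: eqP => [/(congr1 val) /=|_ /eqP].
  by rewrite !inordK.
by rewrite oner_eq0.
Qed.

Lemma indet_neq0 (C : fieldType) k : indet C k != 0.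
Proof.
pose v (_ : 'I_13) : C := 1.
have := frac_evalE (meval v) 'X_(inord k); rewrite /= mevalXU => h.
exact: (place_neq0 (frac_eval_place (meval v)) h (oner_neq0 _)).
Qed.

Lemma ev_params_exch_nu (K L : Type) (ev : K -> L -> Prop) P p i :
  ev_params ev P p -> ev_params ev (exch_nu i P) (exch_nu i p).
Proof. by case=> *; split=> //= j. Qed.

Lemma ev_params_exch_mu (K L : Type) (ev : K -> L -> Prop) P p i :
  ev_params ev P p -> ev_params ev (exch_mu i P) (exch_mu i p).
Proof. by case=> *; split=> //= j. Qed.

(** * Restriction of [L1] to the exceptional line at each of the eight points *)

Section Restricts.
Variables (C : fieldType) (p : params C) (i : 'I_4) (f1 z : C).
Hypothesis hp : admissible p.

Let P : params (ratexpr_g1 C) := map_params (@Defs.lift C) (gen_params C).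

Let ev_f1 : exists r0, set_g1_0 (Defs.lift (gen_f1 C)) r0 /\ evaluates_to r0 p z f1 f1.
Proof. by exists (gen_f1 C); split; [exact: set_g1_0_lift|exact: evaluates_to_f1]. Qed.

Let ev_g1 : exists r0, set_g1_0 (g1 C) r0 /\ evaluates_to r0 p z f1 0.
Proof. by exists 0; split; [exact: set_g1_0_g1|exact: (place0 (evaluates_to_place p f1 z))]. Qed.

Let ev_z : exists r0, set_g1_0 (Defs.lift (gen_z C)) r0 /\ evaluates_to r0 p z f1 z.
Proof. by exists (gen_z C); split; [exact: set_g1_0_lift|exact: evaluates_to_z]. Qed.

Let ev_cst c : exists r0, set_g1_0 (Defs.lift (cst c)) r0 /\ evaluates_to r0 p z f1 c.
Proof. by exists (cst c); split; [exact: set_g1_0_lift|exact: evaluates_to_cst]. Qed.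

Let generic_k1_neq_k2 : k1 (gen_params C) != k2 (gen_params C).
Proof. by apply/eqP => /indet_inj => /(_ isT isT). Qed.

Lemma restricts_to_nu (p' := exch_nu i p) :
  f1 + nu p' ord0 ^+ 2 != 0 -> regular_nu p' z ->
  restricts_to (chart_nu_f C i) (chart_nu_g C i) p f1 z (eqn_nu p' f1 z).
Proof.
move=> X0 zreg yp ym y0; rewrite -(L1_exch_nu _ i).
have [[q0 a0 b0] [n0 m0 _]] := hp.
have e1 := set_g1_0_place C.
have e2 := place_restriction p f1 z.
(* The chart at P_{i+1} is the chart at P_1 for the exchanged parameters. *)
have fE : chart_nu_f C i = Defs.lift (gen_f1 C) * g1 C + nu (exch_nu i P) ord0.
  by rewrite /chart_nu_f /= tpermL.
have gE : chart_nu_g C i = g1 C + (nu (exch_nu i P) ord0)^-1.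
  by rewrite /chart_nu_g /= tpermL.
have eP : ev_params (fun r c => exists r0, set_g1_0 r r0 /\ evaluates_to r0 p z f1 c)
    (exch_nu i P) p'.
  exact/ev_params_exch_nu/restriction_gen.
have p'0 : [/\ q p' != 0, k1 p' != 0, k2 p' != 0, forall j, nu p' j != 0
    & forall j, mu p' j != 0].
  by split=> //= j.
have gen'0 : [/\ q (exch_nu i (gen_params C)) != 0, k1 (gen_params C) != 0,
    k2 (gen_params C) != 0, forall j, nu (exch_nu i (gen_params C)) j != 0
    & forall j, mu (exch_nu i (gen_params C)) j != 0].
  by split=> *; exact: indet_neq0.
(* The cancellation uses only the place [g_1 = 0], over generic parameters. *)
have cancel := ev_cancel_nu e1 (ev_params_exch_nu i (set_g1_0_gen C)) gen'0
  (set_g1_0_lift (gen_f1 C)) (set_g1_0_g1 C) generic_k1_neq_k2.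
rewrite fE gE.
apply: (ev_L1_nu e2 eP p'0 ev_f1 ev_g1 ev_z (ev_cst yp) (ev_cst ym) (ev_cst y0)
  (g1_neq0 C) _ X0 zreg).
(* The intermediate value -1 is a constant, so the numerical stage keeps it, whatever kappa_1 and
   kappa_2 are. *)
exists (- 1); split; first exact: cancel.
have e3 := evaluates_to_place p f1 z.
exact/(placeN e3)/(place1 e3).
Qed.

Lemma restricts_to_mu (p' := exch_mu i p) :
  f1 * mu p' ord0 ^+ 2 + k1 p * k2 p != 0 -> regular_mu p' z ->
  restricts_to (chart_mu_f C i) (chart_mu_g C i) p f1 z (eqn_mu p' f1 z).
Proof.
move=> X0 zreg yp ym y0; rewrite -(L1_exch_mu _ i).
have [[q0 a0 b0] [n0 m0 _]] := hp.
have e1 := set_g1_0_place C.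
have e2 := place_restriction p f1 z.
have mE : mu (exch_mu i P) ord0 = Defs.lift (mu (gen_params C) i) by rewrite /= tpermL.
have fE : chart_mu_f C i
    = Defs.lift (gen_f1 C) * g1 C + k1 (exch_mu i P) / mu (exch_mu i P) ord0.
  by rewrite mE.
have gE : chart_mu_g C i = g1 C + mu (exch_mu i P) ord0 / k2 (exch_mu i P).
  rewrite mE; exact: erefl.
have eP : ev_params (fun r c => exists r0, set_g1_0 r r0 /\ evaluates_to r0 p z f1 c)
    (exch_mu i P) p'.
  exact/ev_params_exch_mu/restriction_gen.
have p'0 : [/\ q p' != 0, k1 p' != 0, k2 p' != 0, forall j, nu p' j != 0
    & forall j, mu p' j != 0].
  by split=> //= j.
have gen'0 : [/\ q (exch_mu i (gen_params C)) != 0, k1 (gen_params C) != 0,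
    k2 (gen_params C) != 0, forall j, nu (exch_mu i (gen_params C)) j != 0
    & forall j, mu (exch_mu i (gen_params C)) j != 0].
  by split=> *; exact: indet_neq0.
have cancel := ev_cancel_mu e1 (ev_params_exch_mu i (set_g1_0_gen C)) gen'0
  (set_g1_0_lift (gen_f1 C)) (set_g1_0_g1 C) generic_k1_neq_k2.
rewrite fE gE.
apply: (ev_L1_mu e2 eP p'0 ev_f1 ev_g1 ev_z (ev_cst yp) (ev_cst ym) (ev_cst y0)
  (g1_neq0 C) _ X0 zreg).
(* Here the intermediate value is the indeterminate kappa_2, which then takes its numerical
   value. *)
exists (k2 (gen_params C)); split; first exact: cancel.
by have [] := evaluates_to_gen p f1 z.
Qed.

End Restricts.

(** * Elementary symmetric functions of the parameters *)

(** The witnesses stay opaque, so later identities involve three unknowns in place of the individual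
    parameters. The homogeneous form in [x] and [y] covers every product of linear factors that
    occurs. *)
Lemma elem_sym3 (F : fieldType) (G : 'I_4 -> F) : (forall i, G i != 0) ->
  exists e1 e2 : F,
  [/\ \sum_(i | i != ord0) G i = e1,
      \sum_(i | i != ord0) (G i)^-1 = e2 / \prod_(i | i != ord0) G i &
      forall x y, \prod_(i | i != ord0) (x - G i * y) =
        x ^+ 3 - e1 * x ^+ 2 * y + e2 * x * y ^+ 2 - \prod_(i | i != ord0) G i * y ^+ 3].
Proof.
move=> G0.
set a := G (lift ord0 ord0); set b := G (lift ord0 (lift ord0 ord0)).
set c := G (lift ord0 (lift ord0 (lift ord0 ord0))).
exists (a + b + c), (a * b + a * c + b * c).
rewrite [\sum_(i | _) G i]big_mkcond [\sum_(i | _) (G i)^-1]big_mkcond.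
rewrite [\prod_(i | _) G i]big_mkcond /=.
rewrite !big_ord_recl !big_ord0 /= -/a -/b -/c; split; [ring| |].
  by field; rewrite /a /b /c !G0.
move=> x y; rewrite [\prod_(i | _) _]big_mkcond /= !big_ord_recl big_ord0 /= -/a -/b -/c.
ring.
Qed.

Lemma elem_sym4 (F : fieldType) (G : 'I_4 -> F) : (forall i, G i != 0) ->
  exists e1 e2 e3 : F,
  [/\ \sum_i G i = e1, \sum_i (G i)^-1 = e3 / \prod_i G i &
      forall x y, \prod_i (x - G i * y) =
        x ^+ 4 - e1 * x ^+ 3 * y + e2 * x ^+ 2 * y ^+ 2 - e3 * x * y ^+ 3
        + \prod_i G i * y ^+ 4].
Proof.
move=> G0; have [e1 [e2 [E1 E2 E3]]] := elem_sym3 G0.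
set a := G ord0; set e := \prod_(i | i != ord0) G i in E2 E3.
have e0 : e != 0 by apply/prodf_neq0 => i _.
(* Adding one root [a] to three: each function is the old one plus [a] times its predecessor. *)
exists (a + e1), (a * e1 + e2), (a * e2 + e).
rewrite (bigD1 ord0) //= E1 (bigD1 ord0) //= E2 (bigD0 G) -/a -/e.
split=> //; first by field; rewrite e0 G0.
by move=> x y; rewrite bigD0 E3 -/a; ring.
Qed.

(** * Square roots, accessory parameters and gauge transforms *)

Section Gauge.
Variables (F : fieldType) (p : params F) (s : F).
Hypotheses (hp : admissible p) (hs : s ^+ 2 = q p).

(** Eliminating the product of the mu by the relation between the parameters turns the product of
    all h and l into the square [q^6 k1^2 (nu_1 ... nu_4)^2 / k2^2]. *)
Lemma root_nu_sqr : root_nu p ^+ 2 = (\prod_j h_nu p s j) * (\prod_j l_nu p s j).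
Proof.
case: hp => [[q0 a0 b0] [n0 m0 rel]].
have s0 : s != 0 by move: q0; rewrite -hs expf_eq0.
have N0 : \prod_i nu p i != 0 by apply/prodf_neq0 => i _.
have M0 : \prod_i mu p i != 0 by apply/prodf_neq0 => i _.
have -> : \prod_j l_nu p s j = (s * k1 p) ^+ 4 / \prod_i mu p i.
  by rewrite -prodfV -prod4_mull.
have -> : \prod_j h_nu p s j = s ^+ 6 * \prod_i nu p i.
  rewrite !bigD0 /h_nu eqxx.
  have -> : \prod_(i | i != ord0) (if i == ord0 then s ^+ 3 * nu p i else s * nu p i)
     = s ^+ 3 * \prod_(i | i != ord0) nu p i.
    by rewrite -prod3_mull; apply: eq_bigr => i /negPf ->.
  ring.
have -> : \prod_i mu p i = k1 p ^+ 2 * k2 p ^+ 2 / (s ^+ 2 * \prod_i nu p i).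
  by rewrite rel hs; field; rewrite q0 N0.
by rewrite /root_nu -hs; field; rewrite ?(a0, b0, N0, s0).
Qed.

Lemma root_mu_sqr : root_mu p ^+ 2 = (\prod_j h_mu p s j) * (\prod_j l_mu p s j).
Proof.
case: hp => [[q0 a0 b0] [n0 m0 rel]].
have s0 : s != 0 by move: q0; rewrite -hs expf_eq0.
have N0 : \prod_i nu p i != 0 by apply/prodf_neq0 => i _.
have M0 : \prod_i mu p i != 0 by apply/prodf_neq0 => i _.
have M'0 : \prod_(i | i != ord0) mu p i != 0 by apply/prodf_neq0 => i _.
have -> : \prod_j h_mu p s j = s ^+ 4 * \prod_i nu p i by rewrite -prod4_mull.
have -> : \prod_j l_mu p s j = s ^+ 2 * k1 p ^+ 4 / \prod_i mu p i.
  have -> : \prod_j l_mu p s j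
      = k1 p / (s * mu p ord0) * ((s * k1 p) ^+ 3 / \prod_(i | i != ord0) mu p i).
    rewrite bigD0 {1}/l_mu eqxx; congr (_ * _).
    by rewrite -prodfV -prod3_mull; apply: eq_bigr => i /negPf; rewrite /l_mu => ->.
  rewrite (bigD0 (mu p)); field.
  by rewrite s0 m0 M'0.
have -> : \prod_i mu p i = k1 p ^+ 2 * k2 p ^+ 2 / (s ^+ 2 * \prod_i nu p i).
  by rewrite rel hs; field; rewrite q0 N0.
by rewrite /root_mu -hs; field; rewrite ?(a0, b0, N0, s0).
Qed.

(** This is the sense in which f_1 is an accessory parameter: [E] is affine in the inverse of
    [f1 + nu_1^2], and the excluded value is its limit at infinite f_1. *)
Lemma E_nu_bij E : K1_nu p != 0 -> E != - s ^+ 3 * K2_nu p ->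
  exists! f1, f1 + nu p ord0 ^+ 2 != 0 /\ E_nu p s f1 = E.
Proof.
case: hp => [[q0 a0 b0] _] K0 EK.
have s0 : s != 0 by move: q0; rewrite -hs expf_eq0.
have W0 : - E / s ^+ 3 - K2_nu p != 0.
  apply: contra_neq EK => /eqP; rewrite subr_eq0 => /eqP <-.
  by field.
(* [W] is the value required of [K1 / (k2 * (f1 + nu_1^2))]. *)
set W := _ - _ in W0.
exists (K1_nu p / (k2 p * W) - nu p ord0 ^+ 2); split.
  split; first by rewrite subrK mulf_neq0 // invr_eq0 mulf_neq0.
  rewrite /E_nu subrK.
  have -> : K1_nu p / (k2 p * (K1_nu p / (k2 p * W))) = W by field; rewrite K0 b0 W0.
  by rewrite /W; field.
move=> f [X0 EE]; apply: (addIr (nu p ord0 ^+ 2)); rewrite subrK.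
have WE : W = K1_nu p / (k2 p * (f + nu p ord0 ^+ 2)).
  by rewrite /W -EE /E_nu; field; rewrite X0 b0 s0.
by rewrite WE; field; rewrite X0 b0 K0.
Qed.

Lemma E_mu_bij E : K1_mu p != 0 -> E != - s * K2_mu p ->
  exists! f1, f1 * mu p ord0 ^+ 2 + k1 p * k2 p != 0 /\ E_mu p s f1 = E.
Proof.
case: hp => [[q0 a0 b0] [_ mn _]] K0 EK.
have m0 : mu p ord0 != 0 by [].
have s0 : s != 0 by move: q0; rewrite -hs expf_eq0.
have W0 : - E / s - K2_mu p != 0.
  apply: contra_neq EK => /eqP; rewrite subr_eq0 => /eqP <-.
  by field.
set W := _ - _ in W0.
(* [X] is the value required of [f1 * nu_5^2 + k1 * k2]. *)
pose X := K1_mu p / (k2 p * mu p ord0 * W).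
have XE : (X - k1 p * k2 p) / mu p ord0 ^+ 2 * mu p ord0 ^+ 2 + k1 p * k2 p = X.
  by field.
have X0 : X != 0 by rewrite mulf_neq0 // invr_eq0 !mulf_neq0.
exists ((X - k1 p * k2 p) / mu p ord0 ^+ 2); split.
  rewrite /E_mu XE; split=> //.
  have -> : K1_mu p / (k2 p * mu p ord0 * X) = W.
    by rewrite /X; field; rewrite K0 b0 W0 m0.
  by rewrite /W; field.
move=> f [Y0 EE].
have WE : W = K1_mu p / (k2 p * mu p ord0 * (f * mu p ord0 ^+ 2 + k1 p * k2 p)).
  by rewrite /W -EE /E_mu; field; rewrite Y0 m0 b0 s0.
have -> : X = f * mu p ord0 ^+ 2 + k1 p * k2 p.
  by rewrite /X WE; field; rewrite Y0 m0 b0 K0.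
by field.
Qed.

(** * The degree 4 equation at P_1 *)

Section Nu.
Variables (f1 z : F) (P y : F -> F).
Hypotheses (hz : regular_nu p z) (hX : f1 + nu p ord0 ^+ 2 != 0)
  (hz' : q p * nu p ord0 - z / q p != 0)
  (hP : P (q p * z) = s ^+ 3 * k2 p / k1 p * P z)
  (hP' : P z = s ^+ 3 * k2 p / k1 p * P (z / q p))
  (hy : eqn_nu p f1 z (y (q p * z)) (y (z / q p)) (y z) = 0).

(** After the shifts of [P] are inserted, the left-hand side is a multiple of the three-term
    equation, as an identity linear in the three values of [y]. *)
Lemma qHeun4_nu :
  qHeun4 (q p) s (h_nu p s) (l_nu p s) (root_nu p) (E_nu p s f1)
    (fun x => P x * y x / (q p * nu p ord0 - x)) z = 0.
Proof.
case: hp => [[q0 a0 b0] [n0 m0 rel]].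
have s0 : s != 0 by move: q0; rewrite -hs expf_eq0.
have Pm : P (z / q p) = k1 p / (s ^+ 3 * k2 p) * P z by rewrite hP'; field; rewrite s0 a0 b0.
rewrite /qHeun4 hP Pm.
have N0 : \prod_(i | i != ord0) nu p i != 0 by apply/prodf_neq0 => i _.
have [a1 [a2 [A1 A2 A3]]] := elem_sym3 n0.
have [e1 [e2 [e3 [E1 E2 E3]]]] := elem_sym4 m0.
(* The relation between the parameters enters here, eliminating the last symmetric function of the
   mu. *)
have ME : \prod_i mu p i = k1 p ^+ 2 * k2 p ^+ 2
    / (s ^+ 2 * nu p ord0 * \prod_(i | i != ord0) nu p i).
  by rewrite rel hs (bigD0 (nu p)); field; rewrite q0 N0 n0.
(* The extra factor q in h_1 makes its linear factor [z - q^2 nu_1], which cancels the gauge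
   denominator at [z / q]. *)
have hprod : \prod_i (z - h_nu p s i * s)
   = (z - s ^+ 4 * nu p ord0) * \prod_(i | i != ord0) (z - nu p i * s ^+ 2).
  rewrite bigD0 /h_nu eqxx; congr (_ * _); first by ring.
  by apply: eq_bigr => i /negPf ->; ring.
have lprod : \prod_i (z - l_nu p s i * s^-1)
   = \prod_i (- k1 p - mu p i * - z) / \prod_i mu p i.
  rewrite -prodfV -big_split /=; apply: eq_bigr => i _.
  by rewrite /l_nu; field; rewrite m0 s0.
have hlsum : \sum_i (h_nu p s i + l_nu p s i)
   = s ^+ 3 * nu p ord0 + s * (\sum_(i | i != ord0) nu p i)
     + s * k1 p * \sum_i (mu p i)^-1.
  rewrite big_split /= -[X in _ + X]mulr_sumr; congr (_ + _).
  rewrite (bigD1 ord0) //= mulr_sumr /h_nu eqxx; congr (_ + _).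
  by apply: eq_bigr => i /negPf ->.
have hlVsum : \sum_i ((h_nu p s i)^-1 + (l_nu p s i)^-1)
   = (s ^+ 3 * nu p ord0)^-1 + s^-1 * (\sum_(i | i != ord0) (nu p i)^-1)
     + (s * k1 p)^-1 * \sum_i mu p i.
  rewrite big_split /=; congr (_ + _); last first.
    by rewrite mulr_sumr; apply: eq_bigr => i _; rewrite /l_nu invf_div mulrC.
  rewrite (bigD1 ord0) //= mulr_sumr /h_nu eqxx; congr (_ + _).
  by apply: eq_bigr => i /negPf ->; rewrite invfM.
rewrite {}hprod {}lprod {}hlsum {}hlVsum /E_nu /K1_nu /K2_nu /root_nu (bigD0 (nu p)).
move: hy hz hz' hX; rewrite /eqn_nu /regular_nu.
move: n0 a0 b0 q0 m0 rel hs ME E1 E2 E3 A1 A2 A3 N0.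
case: (p) => /= q a b n m n0 a0 b0 q0 m0 rel qE ME E1 E2 E3 A1 A2 A3 N0.
(* Products are put into the form [x - G i * y] expected by the symmetric function expansions. *)
have -> : \prod_(j | j != ord0) (q * n j - z) = \prod_(j | j != ord0) (- z - n j * - q).
  by apply: eq_bigr => i _; ring.
have -> : \prod_(j | j != ord0) (n ord0 - n j) = \prod_(j | j != ord0) (n ord0 - n j * 1).
  by apply: eq_bigr => i _; ring.
have -> : \prod_j (b - n ord0 * m j) = \prod_j (b - m j * n ord0).
  by apply: eq_bigr => i _; ring.
rewrite (bigD0 n) !A3 !E3 !A1 !A2 !E1 !E2 !ME.
have := n0 ord0.
move: (\prod_(i | _) _) (n ord0) (y (q * z)) (y (z / q)) (y z) (P z) N0.
rewrite -qE => a3 n1 yp ym y0 Pz a30 n10 Y [z0 z1 z2 z3] z4 X0.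
(* The multiplier, read off from the coefficients of [y (z / q)] on both sides. *)
pose M := Pz * a * s ^+ 4 * (n1 * a3) * z ^+ 2 / (s ^+ 3 * b).
rewrite -[RHS](mulr0 M) -Y {Y} /M.
field.
have w1 : s ^+ 2 * n1 - s ^+ 2 * z != 0 by rewrite -mulrBr mulf_neq0 // qE.
have w2 : s ^+ 2 * n1 * s ^+ 2 - z != 0.
  have -> : s ^+ 2 * n1 * s ^+ 2 - z = s ^+ 2 * (s ^+ 2 * n1 - z / s ^+ 2) by field.
  by rewrite mulf_neq0 // qE.
by rewrite z3 z0 a0 a30 n10 s0 z2 b0 X0 z1 w1 w2.
Qed.

End Nu.

(** * The degree 4 equation at P_5 *)

Section Mu.
Variables (f1 z : F) (P y : F -> F).
Hypotheses (hz : regular_mu p z) (hX : f1 * mu p ord0 ^+ 2 + k1 p * k2 p != 0)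
  (hz' : k1 p - mu p ord0 * (q p * z) != 0)
  (hP : P (q p * z) = s ^+ 3 * k2 p / k1 p * P z)
  (hP' : P z = s ^+ 3 * k2 p / k1 p * P (z / q p))
  (hy : eqn_mu p f1 z (y (q p * z)) (y (z / q p)) (y z) = 0).

Lemma qHeun4_mu :
  qHeun4 (q p) s (h_mu p s) (l_mu p s) (root_mu p) (E_mu p s f1)
    (fun x => P x * y x / (k1 p - mu p ord0 * x)) z = 0.
Proof.
case: hp => [[q0 a0 b0] [n0 m0 rel]].
have s0 : s != 0 by move: q0; rewrite -hs expf_eq0.
have Pm : P (z / q p) = k1 p / (s ^+ 3 * k2 p) * P z by rewrite hP'; field; rewrite s0 a0 b0.
rewrite /qHeun4 hP Pm.
have N0 : \prod_i nu p i != 0 by apply/prodf_neq0 => i _.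
have M0 : \prod_(i | i != ord0) mu p i != 0 by apply/prodf_neq0 => i _.
have [a1 [a2 [A1 A2 A3]]] := elem_sym3 m0.
have [e1 [e2 [e3 [E1 E2 E3]]]] := elem_sym4 n0.
have ME : \prod_(i | i != ord0) mu p i
    = k1 p ^+ 2 * k2 p ^+ 2 / (s ^+ 2 * mu p ord0 * \prod_i nu p i).
  by rewrite rel hs (bigD0 (mu p)); field; rewrite q0 N0 m0.
have hprod : \prod_i (z - h_mu p s i * s) = \prod_i (z - nu p i * s ^+ 2).
  by apply: eq_bigr => i _; rewrite /h_mu; ring.
(* The shifted l_1 gives the factor [z - k1 / (q nu_5)], which cancels the gauge denominator at
   [q z]. *)
have lprod : \prod_i (z - l_mu p s i * s^-1)
   = (z - k1 p / (s ^+ 2 * mu p ord0)) *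
     (\prod_(i | i != ord0) (- k1 p - mu p i * - z) / \prod_(i | i != ord0) mu p i).
  rewrite bigD0 {1}/l_mu eqxx; congr (_ * _); first by field; rewrite m0 s0.
  rewrite -prodfV -big_split /=; apply: eq_bigr => i /negPf i0.
  by rewrite /l_mu i0; field; rewrite m0 s0.
have hlsum : \sum_i (h_mu p s i + l_mu p s i)
   = s * (\sum_i nu p i)
     + (k1 p / (s * mu p ord0) + s * k1 p * \sum_(i | i != ord0) (mu p i)^-1).
  rewrite big_split /= -mulr_sumr; congr (_ + _).
  rewrite (bigD1 ord0) //= mulr_sumr /l_mu eqxx; congr (_ + _).
  by apply: eq_bigr => i /negPf ->.
have hlVsum : \sum_i ((h_mu p s i)^-1 + (l_mu p s i)^-1)
   = s^-1 * (\sum_i (nu p i)^-1)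
     + (s * mu p ord0 / k1 p + (s * k1 p)^-1 * \sum_(i | i != ord0) mu p i).
  rewrite big_split /=; congr (_ + _).
    by rewrite mulr_sumr; apply: eq_bigr => i _; rewrite /h_mu invfM.
  rewrite (bigD1 ord0) //= mulr_sumr /l_mu eqxx invf_div; congr (_ + _).
  by apply: eq_bigr => i /negPf ->; rewrite invf_div mulrC.
rewrite {}hprod {}lprod {}hlsum {}hlVsum /E_mu /K1_mu /K2_mu /root_mu.
move: hy hz hz' hX; rewrite /eqn_mu /regular_mu.
move: n0 a0 b0 q0 m0 rel hs ME E1 E2 E3 A1 A2 A3 N0 M0.
case: (p) => /= q a b n m n0 a0 b0 q0 m0 rel qE ME E1 E2 E3 A1 A2 A3 N0 M0.
have -> : \prod_j (q * n j - z) = \prod_j (- z - n j * - q).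
  by apply: eq_bigr => i _; ring.
have -> : \prod_(j | j != ord0) (m ord0 - m j) = \prod_(j | j != ord0) (m ord0 - m j * 1).
  by apply: eq_bigr => i _; ring.
rewrite !A3 !E3 !A1 !A2 !E1 !E2 !ME.
have := m0 ord0.
move: (\prod_i n i) (m ord0) (y (q * z)) (y (z / q)) (y z) (P z) N0.
rewrite -qE => N m5 yp ym y0 Pz N0 m50 Y [z0 z1 z2 z3] z4 X0.
(* Again the ratio of the coefficients of [y (z / q)]. *)
pose M := Pz * a * s ^+ 4 * N * z ^+ 2 / (s ^+ 3 * b * m5).
rewrite -[RHS](mulr0 M) -Y {Y} /M.
field.
have w1 : a * b + f1 * m5 ^+ 2 != 0 by rewrite addrC.
by rewrite z1 z0 b0 a0 N0 m50 s0 z3 w1 z2 z4.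
Qed.

End Mu.
End Gauge.

(** * Assembly for all eight points through the exchanged parameters *)

Theorem mainTheorem3 (R : realType) (p : params (complex R))
    (s lq lam : complex R) (Om : complex R -> Prop)
    (zlam : complex R -> complex R)
    (hp : admissible p)
    (hs : s ^+ 2 = q p)
    (hlq : cexp lq = q p)
    (hlam : cexp (lam * lq) = s ^+ 3 * k2 p / k1 p)
    (hOm : q_stable (q p) Om)
    (hzlam : power_branch (q p) lq lam Om zlam) :
  (forall i : 'I_4, let p' := exch_nu i p in
    [/\ forall f1, f1 + nu p' ord0 ^+ 2 != 0 -> forall z, regular_nu p' z ->
          restricts_to (chart_nu_f (complex R) i) (chart_nu_g (complex R) i)
            p f1 z (eqn_nu p' f1 z),
        root_nu p' ^+ 2 = (\prod_j h_nu p' s j) * (\prod_j l_nu p' s j),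
        forall f1, f1 + nu p' ord0 ^+ 2 != 0 -> forall y : complex R -> complex R,
          solves Om (regular_nu p') (q p) (eqn_nu p' f1) y ->
          forall z, Om z -> regular_nu p' z -> q p * nu p' ord0 - z / q p != 0 ->
          qHeun4 (q p) s (h_nu p' s) (l_nu p' s) (root_nu p') (E_nu p' s f1)
            (fun x => zlam x * y x / (q p * nu p' ord0 - x)) z = 0 &
        K1_nu p' != 0 -> forall E, E != - s ^+ 3 * K2_nu p' ->
          exists! f1, f1 + nu p' ord0 ^+ 2 != 0 /\ E_nu p' s f1 = E]) /\
  (forall i : 'I_4, let p' := exch_mu i p in
    [/\ forall f1, f1 * mu p' ord0 ^+ 2 + k1 p * k2 p != 0 ->
          forall z, regular_mu p' z ->
          restricts_to (chart_mu_f (complex R) i) (chart_mu_g (complex R) i)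
            p f1 z (eqn_mu p' f1 z),
        root_mu p' ^+ 2 = (\prod_j h_mu p' s j) * (\prod_j l_mu p' s j),
        forall f1, f1 * mu p' ord0 ^+ 2 + k1 p * k2 p != 0 ->
          forall y : complex R -> complex R,
          solves Om (regular_mu p') (q p) (eqn_mu p' f1) y ->
          forall z, Om z -> regular_mu p' z -> k1 p - mu p' ord0 * (q p * z) != 0 ->
          qHeun4 (q p) s (h_mu p' s) (l_mu p' s) (root_mu p') (E_mu p' s f1)
            (fun x => zlam x * y x / (k1 p - mu p' ord0 * x)) z = 0 &
        K1_mu p' != 0 -> forall E, E != - s * K2_mu p' ->
          exists! f1, f1 * mu p' ord0 ^+ 2 + k1 p * k2 p != 0 /\ E_mu p' s f1 = E]).
Proof.
have hP z : Om z -> zlam (q p * z) = s ^+ 3 * k2 p / k1 p * zlam z.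
  by move=> /hzlam [_ -> _]; rewrite hlam.
(* The previous rule applied at [z / q], which lies in [Om] by stability. *)
have hP' z : Om z -> zlam z = s ^+ 3 * k2 p / k1 p * zlam (z / q p).
  move=> Omz; have [_ _ Omz'] := hOm _ Omz.
  rewrite -(hP _ Omz') mulrC divfK //.
  by case: hp => [[]].
split=> i p'.
- have hp' : admissible p' by exact: admissible_exch_nu.
  split.
  + by move=> f1 X0 z zreg; exact: restricts_to_nu.
  + exact: root_nu_sqr.
  + move=> f1 X0 y hy z Omz zreg z0.
    by apply: (@qHeun4_nu _ p') => //; [exact: hP|exact: hP'|exact: hy].
  + by move=> K0 E; exact: E_nu_bij.
- have hp' : admissible p' by exact: admissible_exch_mu.
  split.
  + by move=> f1 X0 z zreg; exact: restricts_to_mu.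
  + exact: root_mu_sqr.
  + move=> f1 X0 y hy z Omz zreg z0.
    by apply: (@qHeun4_mu _ p') => //; [exact: hP|exact: hP'|exact: hy].
  + by move=> K0 E; exact: E_mu_bij.
Qed.
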